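(* Let $T>0$, $d\ge1$, $x\in\mathbb{R}^d$. Let $b:[0,T]\times\mathbb{R}^d\to\mathbb{R}^d$ be a measurable function of at most linear growth which is continuous in the second variable (uniformly with respect to the first). Let $(X_t^x)_{t\in[0,T]}$ be a strong solution of the mean-field SDE $$dX_t^x=b(t,\mathbb{E}[X_t^x])\,dt+dB_t,\quad t\in[0,T],\quad X_0^x=x.$$ Then $u(t):=\mathbb{E}[X_t^x]$, $t\in[0,T]$, is a solution of the ODE $$d\,u(t)=b(t,u(t))\,dt,\quad t\in[0,T],\quad u(0)=x.$$
   Context: $B$ is $d$-dimensional Brownian motion. $b$ is of at most linear growth if there is $C>0$ with $\|b(t,z)\|\le C(1+\|z\|)$ for all $t\in[0,T]$, $z\in\mathbb{R}^d$; $b$ is continuous in the second variable if for all $z_1\in\mathbb{R}^d$, $\varepsilon>0$ there is $\delta>0$ such that for all $t\in[0,T]$ and all $z_2$ with $\|z_1-z_2\|<\delta$ one has $\|b(t,z_1)-b(t,z_2)\|<\varepsilon$. A strong solution is a continuous process on a complete probability space carrying $B$, adapted to the $\mathbb{P}$-augmented filtration generated by $B$, with $\mathbb{E}\|X_t^x\|<\infty$ for all $t$, which satisfies the equation a.s. A solution of the ODE is understood in the Carathéodory sense, i.e. $u(t)=x+\int_0^t b(s,u(s))\,ds$ for all $t\in[0,T]$. *)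

(* Defs.v *)
From HB Require Import structures.
From mathcomp Require Import all_boot all_order all_algebra.
From mathcomp Require Import all_classical all_reals all_analysis.

Set Implicit Arguments.
Unset Strict Implicit.
Unset Printing Implicit Defensive.

Import Order.TTheory GRing.Theory Num.Theory.
Import numFieldNormedType.Exports.

Local Open Scope classical_set_scope.
Local Open Scope ring_scope.

(* The sigma-algebra of R^d is the one generated by the coordinates, as for
   [d.-tuple R] in the library; it coincides with the Borel sigma-algebra. *)
Section measurable_rV.
Context {R : realType} (d : nat).

Let coord (i : 'I_d) (z : 'rV[R]_d) : R := z 0 i.

Let rV_set0 : g_sigma_preimage coord set0.
Proof. exact: sigma_algebra0. Qed.

Let rV_setC A : g_sigma_preimage coord A -> g_sigma_preimage coord (~` A).
Proof. exact: sigma_algebraC. Qed.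

Let rV_bigcup (F : _^nat) : (forall i, g_sigma_preimage coord (F i)) ->
  g_sigma_preimage coord (\bigcup_i (F i)).
Proof. exact: sigma_algebra_bigcup. Qed.

HB.instance Definition _ := @isMeasurable.Build default_measure_display
  'rV[R]_d (g_sigma_preimage coord) rV_set0 rV_setC rV_bigcup.

End measurable_rV.

(* The library norm on ['rV[R]_d] is the sup norm. *)
Definition enorm (R : realType) (d : nat) (z : 'rV[R]_d) : R :=
  Num.sqrt (\sum_(i < d) z 0 i ^+ 2).

Section coefficients.
Context (R : realType) (d : nat).
Variables (T : R) (b : R -> 'rV[R]_d -> 'rV[R]_d).

Definition measurable_coef :=
  measurable_fun (`[0, T] `*` [set: 'rV[R]_d])
    (fun p : R * 'rV[R]_d => b p.1 p.2).

Definition linear_growth :=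
  exists2 C : R, 0 < C &
    forall t : R, t \in `[0, T] -> forall z, enorm (b t z) <= C * (1 + enorm z).

Definition continuous_second_variable :=
  forall (z1 : 'rV[R]_d) (e : R), 0 < e -> exists2 delta : R, 0 < delta &
    forall t : R, t \in `[0, T] -> forall z2, enorm (z1 - z2) < delta ->
      enorm (b t z1 - b t z2) < e.

Definition vint (t : R) (f : R -> 'rV[R]_d) : 'rV[R]_d :=
  \row_(i < d) (\int[lebesgue_measure]_(s in `[0, t]) (f s 0 i)).

Definition caratheodory_solution (x : 'rV[R]_d) (u : R -> 'rV[R]_d) :=
  [/\ u 0 = x,
      forall i : 'I_d, lebesgue_measure.-integrable `[0, T]
        (fun s => (b s (u s) 0 i)%:E) &
      forall t : R, t \in `[0, T] -> u t = x + vint t (fun s => b s (u s))].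

End coefficients.

(* A process is indexed by all of R, but only its values at times in [0, T]
   matter below. *)
Section processes.
Context (R : realType) (d : nat) (dO : measure_display)
  (Omega : measurableType dO) (P : probability Omega R).
Variable T : R.

Definition process := R -> {RV P >-> 'rV[R]_d}.

Definition natural_filtration (B : process) (t : R) : set (set Omega) :=
  <<s \bigcup_(s in `[0, t]) preimage_set_system setT (B s) measurable >>.

Definition augmented_filtration (B : process) (t : R) : set (set Omega) :=
  <<s natural_filtration B t `|` P.-negligible >>.

Definition adapted (F : R -> set (set Omega)) (X : process) :=
  forall t : R, t \in `[0, T] ->
    preimage_set_system setT (X t) measurable `<=` F t.

Definition continuous_paths (X : process) :=
  {ae P, forall w, {within `[0, T], continuous (fun t : R => X t w)}}.

Definition independent_of (Y : Omega -> 'rV[R]_d) (G : set (set Omega)) :=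
  forall (A : set Omega) (D : set 'rV[R]_d), G A -> measurable D ->
    P (A `&` Y @^-1` D) = (P A * P (Y @^-1` D))%E.

(* [Y] has law N(0, v I_d), the product of [d] copies of N(0, v); here [v] must
   be positive, as [normal_prob] is not a Dirac mass for deviation 0. *)
Definition isotropic_gaussian (v : R) (Y : Omega -> 'rV[R]_d) :=
  forall D : 'I_d -> set R, (forall i, measurable (D i)) ->
    P [set w | forall i, D i (Y w 0 i)] =
    (\prod_(i < d) normal_prob 0 (Num.sqrt v) (D i))%E.

Definition brownian_motion (B : process) :=
  [/\ {ae P, forall w, B 0 w = 0},
      forall s t : R, 0 <= s -> s < t -> t <= T ->
        independent_of (fun w => B t w - B s w) (natural_filtration B s),
      forall s t : R, 0 <= s -> s < t -> t <= T ->
        isotropic_gaussian (t - s) (fun w => B t w - B s w) &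
      continuous_paths B].

Definition mean (Y : Omega -> 'rV[R]_d) : 'rV[R]_d :=
  \row_(i < d) fine ('E_P[fun w => Y w 0 i]).

(* Integrability of the drift is not required separately: for a measurable [b]
   of linear growth, it follows from the continuity of the paths of [X] and
   [B], which forces the mean of [X] to be continuous on [0, T]. *)
Definition strong_solution (b : R -> 'rV[R]_d -> 'rV[R]_d) (x : 'rV[R]_d)
    (B X : process) :=
  [/\ continuous_paths X,
      adapted (augmented_filtration B) X,
      forall t : R, t \in `[0, T] -> ('E_P[fun w => enorm (X t w)] < +oo)%E,
      {ae P, forall w, X 0 w = x} &
      {ae P, forall w, forall t : R, t \in `[0, T] ->
        X t w = x + vint t (fun s => b s (mean (X s))) + B t w}].

End processes.

(* Main.v *)
Require Import Defs.
From mathcomp Require Import all_boot all_order all_algebra.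
From mathcomp Require Import all_classical all_reals all_analysis.
From mathcomp Require Import measurable_realfun.

Set Implicit Arguments.
Unset Strict Implicit.
Unset Printing Implicit Defensive.

Import Order.TTheory GRing.Theory Num.Theory.
Import numFieldNormedType.Exports.

Local Open Scope classical_set_scope.
Local Open Scope ring_scope.

(* The drift is deterministic, so taking means in the equation kills B, whose
   increments have symmetric laws, and leaves u(t) = x + int_0^t b(s, u(s)) ds,
   the integral being a priori a junk value. But along a single good path
   u = X - B on [0, T], so u is continuous; linear growth then makes
   s |-> b(s, u(s)) integrable and the integral genuine. *)

(** The sigma-algebra of ['rV[R]_d] is generated by an iterated union; as an indexed one, a
    generator comes with its coordinate. *)
Lemma coord_set_systemE (R : realType) (d : nat) :
  \big[setU/set0]_(i < d) preimage_set_system [set: 'rV[R]_d]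
    (fun z => z 0 i) measurable =
  \bigcup_(i in [set: 'I_d]) preimage_set_system [set: 'rV[R]_d]
    (fun z => z 0 i) measurable.
Proof.
by apply/seteqP; split => [A|A]; rewrite -bigcup_seq;
  move=> [i _ Ai]; exists i => //=; rewrite ?mem_index_enum.
Qed.

Lemma measurable_coord (R : realType) (d : nat) (i : 'I_d) :
  measurable_fun [set: 'rV[R]_d] (fun z : 'rV[R]_d => z 0 i).
Proof.
move=> _ D mD; apply: sub_sigma_algebra; rewrite coord_set_systemE.
by exists i => //; exists D.
Qed.

Lemma measurable_fun_rV (dT : measure_display) (T : measurableType dT)
    (R : realType) (d : nat) (D : set T) (f : T -> 'rV[R]_d) :
  (forall i, measurable_fun D (fun t => f t 0 i)) -> measurable_fun D f.
Proof.
move=> mf mD; apply: measurability => // _ [A + <-].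
rewrite coord_set_systemE => -[i _ [C mC <-]].
by rewrite setTI; exact: mf.
Qed.

Lemma measurable_fun_within_pair (d d1 d2 : measure_display)
    (T : measurableType d) (T1 : measurableType d1) (T2 : measurableType d2)
    (D : set T) (f : T -> T1) (g : T -> T2) :
  measurable_fun D f -> measurable_fun D g ->
  measurable_fun D (fun t => (f t, g t)).
Proof.
move=> mf mg mD; apply: measurability => // _ [A + <-].
by move=> [[C mC <-]|[C mC <-]]; rewrite setTI; [exact: mf|exact: mg].
Qed.

Lemma le_coord_enorm (R : realType) (d : nat) (z : 'rV[R]_d) (i : 'I_d) :
  `|z 0 i| <= enorm z.
Proof.
rewrite -sqrtr_sqr ler_wsqrtr// (bigD1 i)//= lerDl.
by apply: sumr_ge0 => j _; exact: sqr_ge0.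
Qed.

Lemma enorm_le_sum (R : realType) (d : nat) (z : 'rV[R]_d) :
  enorm z <= \sum_(i < d) `|z 0 i|.
Proof.
have [S0 Sle] : 0 <= \sum_(i < d) `|z 0 i| /\
    \sum_(i < d) z 0 i ^+ 2 <= (\sum_(i < d) `|z 0 i|) ^+ 2.
  (* Nonnegativity travels with the bound, because the cross term of [(s + s') ^+ 2] has to be
     dropped. *)
  apply: (big_ind2 (fun s q => 0 <= s /\ q <= s ^+ 2)).
  - by rewrite expr0n.
  - move=> s q s' q' [s0 qs] [s'0 qs']; split; first exact: addr_ge0.
    rewrite sqrrD addrAC (le_trans (lerD qs qs'))// lerDl.
    by rewrite mulrn_wge0// mulr_ge0.
  - by move=> i _; rewrite real_normK ?num_real.
by rewrite -(ger0_norm S0) -sqrtr_sqr ler_wsqrtr.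
Qed.

Lemma measurable_enorm (R : realType) (d : nat) :
  measurable_fun [set: 'rV[R]_d] (@enorm R d).
Proof.
apply: measurableT_comp.
  by apply: continuous_measurable_fun; exact: sqrt_continuous.
apply: measurable_sum => i; apply: measurable_funX.
exact: measurable_coord.
Qed.

(** The centred density is even and Lebesgue measure is invariant under reflection. The explicit
    formula [normal_pdfE] requires [s != 0]. *)
Lemma normal_prob0N (R : realType) (s : R) (A : set R) :
  s != 0 -> measurable A -> normal_prob 0 s (-%R @^-1` A) = normal_prob 0 s A.
Proof.
move=> s0 mA; rewrite /normal_prob.
have mN : measurable_fun [set: R] (-%R : R -> measurableTypeR R).
  exact: oppr_measurable.
have pdfN r : normal_pdf 0 s (- r) = normal_pdf 0 s r.
  by rewrite !normal_pdfE// /normal_fun !subr0 sqrrN.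
transitivity (\int[pushforward lebesgue_measure
    (-%R : R -> measurableTypeR R)]_(r in A) (normal_pdf 0 s r)%:E)%E.
  rewrite ge0_integral_pushforward//=.
  - by apply: eq_integral => r _ /=; rewrite pdfN.
  - apply/measurable_EFinP; apply: measurable_funTS.
    exact: measurable_normal_pdf.
  - by move=> r _; rewrite lee_fin normal_pdf_ge0.
by apply: eq_measure_integral => D mD _; exact: lebesgue_measureN.
Qed.

(** [Y] and [- Y] have the same law, so the mean equals its own opposite; integrability makes it
    finite, and twice a real number is zero only at zero. *)
Lemma symmetric_integral0 (dO : measure_display) (Omega : measurableType dO)
    (R : realType) (P : probability Omega R) (Y : Omega -> R) :
  measurable_fun [set: Omega] Y -> P.-integrable [set: Omega] (EFin \o Y) ->
  (forall A : set R, measurable A -> P (Y @^-1` (-%R @^-1` A)) = P (Y @^-1` A)) ->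
  (\int[P]_w (Y w)%:E = 0)%E.
Proof.
move=> mY iY symY.
pose NY := -%R \o Y.
have mNY : measurable_fun [set: Omega] NY by exact: measurableT_comp.
have iNY : P.-integrable [set: Omega] (EFin \o NY).
  rewrite (_ : _ \o _ = -%E \o (EFin \o Y))//; exact: integrableN.
have : (\int[P]_w (Y w)%:E = \int[P]_w (NY w)%:E)%E.
  transitivity (\int[pushforward P Y]_y y%:E)%E.
    by rewrite integral_pushforward.
  transitivity (\int[pushforward P NY]_y y%:E)%E.
    by apply: eq_measure_integral => A mA _; exact: esym (symY A mA).
  by rewrite integral_pushforward.
have fY : (\int[P]_w (Y w)%:E)%E \is a fin_num.
  exact: integrable_fin_num.
have -> : (\int[P]_w (NY w)%:E)%E = (- \int[P]_w (Y w)%:E)%E.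
  rewrite -integralN; first by [].
  by apply: integrable_add_def.
rewrite -(fineK fY) -EFinN => -[/eqP]; rewrite -addr_eq0 -mulr2n mulrn_eq0/=.
by move=> /eqP ->.
Qed.

(** Since the total mass is positive, the almost sure events form a proper filter. This is what
    allows a single good path to be picked. *)
Lemma probability_ae_exists (dO : measure_display) (Omega : measurableType dO)
    (R : realType) (P : probability Omega R) (Q : Omega -> Prop) :
  {ae P, forall w, Q w} -> exists w, Q w.
Proof.
have P0 : (0 < P [set: Omega])%E by rewrite probability_setT lte01.
have PF : ProperFilter (almost_everywhere P).
  exact: ae_properfilter_algebraOfSetsType.
by move=> /filter_ex.
Qed.

Lemma within_continuous_coord (R : realType) (d : nat) (A : set R)
    (f : R -> 'rV[R]_d) (i : 'I_d) :
  {within A, continuous f} -> {within A, continuous (fun t => f t 0 i)}.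
Proof.
apply: (@within_continuous_comp _ _ _ A f (fun z : 'rV[R]_d => z 0 i)) => z _.
exact: coord_continuous.
Qed.

(** The drift term is one fixed vector, the same for all [w], so each coordinate of [X t] is almost
    surely a constant plus a centred Gaussian. *)
Lemma mean_strong_solution (R : realType) (T : R) (d : nat) (x : 'rV[R]_d)
    (b : R -> 'rV[R]_d -> 'rV[R]_d)
    (dO : measure_display) (Omega : measurableType dO)
    (P : probability Omega R) (B X : process d P)
    (BM : brownian_motion T B) (sol : strong_solution T b x B X) (t : R) :
  t \in `[0, T] ->
  mean P (X t) = x + vint t (fun s => b s (mean P (X s))).
Proof.
move=> tT; have [_ _ intX X0 eqX] := sol; have [B0 _ gaussB _] := BM.
have mX (s : R) (i : 'I_d) :
    measurable_fun [set: Omega] (fun w => X s w 0 i).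
  exact: measurableT_comp (measurable_coord i) _.
have mB (s : R) (i : 'I_d) :
    measurable_fun [set: Omega] (fun w => B s w 0 i).
  exact: measurableT_comp (measurable_coord i) _.
have := tT; rewrite in_itv/= => /andP[].
(* Time 0 is separate, since Gaussian increments are given only over intervals of positive
   length. *)
rewrite le_eqVlt => /predU1P[<- _|t0 tleT].
  apply/rowP => i; rewrite !mxE set_itv1 Rintegral_set1 addr0 unlock.
  rewrite (ae_eq_integral (cst (x 0 i)%:E))//.
  - by rewrite integral_cst//= probability_setT mule1.
  - exact/measurable_EFinP.
  - by apply: filterS X0 => w -> _.
apply/rowP => i; set v := vint t _; rewrite !mxE unlock.
pose c := x 0 i + v 0 i.
(* The law is known for increments only; [B 0] vanishes almost surely. *)
pose Y w := B t w 0 i - B 0 w 0 i.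
have mY : measurable_fun [set: Omega] Y by exact: measurable_funB.
have iX : P.-integrable [set: Omega] (EFin \o (fun w => X t w 0 i)).
  apply/integrableP; split; first exact/measurable_EFinP.
  apply: le_lt_trans (intX _ tT); rewrite unlock.
  apply: ge0_le_integral => //=.
  - by apply/measurable_EFinP/measurableT_comp.
  - by apply/measurable_EFinP/measurableT_comp => //; exact: measurable_enorm.
  - by move=> w _; rewrite lee_fin le_coord_enorm.
have XcY : ae_eq P [set: Omega] (fun w => (X t w 0 i)%:E)
    (fun w => (c + Y w)%:E).
  apply: filterS2 B0 eqX => w B0w Xw _; rewrite Xw// !mxE /Y B0w !mxE subr0.
  by rewrite /c/= !mxE.
(* Integrability of [Y] is inherited from [X t] through the equation, without computing Gaussian
   moments. *)
have iXc : P.-integrable [set: Omega] (fun w => (X t w 0 i)%:E - c%:E)%E.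
  by apply: integrableB => //; exact: finite_measure_integrable_cst.
have YXc : ae_eq P [set: Omega] (EFin \o Y) (fun w => (X t w 0 i)%:E - c%:E)%E.
  by apply: filterS XcY => w /(_ I) -> _ /=; rewrite -EFinB addrAC subrr add0r.
have iY : P.-integrable [set: Omega] (EFin \o Y).
  have /integrableP[mXc Xc_fin] := iXc.
  apply/integrableP; split; first exact/measurable_EFinP.
  rewrite (ae_eq_integral (fun w => `|(X t w 0 i)%:E - c%:E|)%E)//.
  - by apply/measurable_EFinP/measurableT_comp.
  - exact: measurableT_comp.
  - exact: (ae_eq_abse YXc).
have st0 : Num.sqrt t != 0 by rewrite gt_eqF// sqrtr_gt0.
have lawY A : measurable A -> P (Y @^-1` A) = normal_prob 0 (Num.sqrt t) A.
  move=> mA; have := gaussB 0 t (lexx _) t0 tleT.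
  (* Marginal law of coordinate [i]: the other factors of the product equal 1. *)
  move=> /(_ (fun j => if j == i then A else setT)).
  rewrite subr0 (bigD1 i)//= eqxx big1 ?mule1; last first.
    by move=> j /negbTE ->; rewrite probability_setT.
  move=> <-; last by move=> j; case: ifP.
  congr (P _); apply/seteqP; split => w /=.
    by move=> AY j; case: eqP => // ->; rewrite !mxE.
  by move=> /(_ i); rewrite eqxx !mxE.
have EY0 : (\int[P]_w (Y w)%:E = 0)%E.
  apply: symmetric_integral0 => // A mA.
  rewrite !lawY ?normal_prob0N// -[X in measurable X]setTI.
  exact: oppr_measurable.
rewrite (ae_eq_integral (fun w => (c + Y w)%:E)%E)//.
- under eq_integral do rewrite EFinD.
  rewrite integralD//=; last exact: finite_measure_integrable_cst.
  by rewrite EY0 adde0 integral_cst//= probability_setT mule1 /c !mxE.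
- exact/measurable_EFinP.
- by apply/measurable_EFinP; exact: measurable_funD.
Qed.

Theorem theorem3p6 (R : realType) (T : R) (d : nat) (x : 'rV[R]_d)
    (b : R -> 'rV[R]_d -> 'rV[R]_d)
    (dO : measure_display) (Omega : measurableType dO)
    (P : probability Omega R) (B X : process d P)
    (T_gt0 : 0 < T) (d_ge1 : (1 <= d)%N)
    (b_meas : measurable_coef T b)
    (b_growth : linear_growth T b)
    (b_cont : continuous_second_variable T b)
    (P_complete : measure_is_complete P)
    (B_brownian : brownian_motion T B)
    (X_solution : strong_solution T b x B X) :
  caratheodory_solution T b x (fun t => mean P (X t)).
Proof.
have u_eq := mean_strong_solution B_brownian X_solution.
have T0 : 0 \in `[0, T] by rewrite in_itv/= lexx ltW.
(* The integral equation is [u_eq] itself and the initial value its case at time 0; integrability of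
   the drift remains. *)
split => //.
  rewrite u_eq//; apply/rowP => i.
  by rewrite !mxE set_itv1 Rintegral_set1 addr0.
pose u t := mean P (X t); rewrite -/u in u_eq *.
have [cX _ _ _ eqX] := X_solution; have [_ _ _ cB] := B_brownian.
(* The exceptional null sets do not depend on [t], so one [w] serves all times. *)
have [w [cXw [cBw eqw]]] : exists w,
    {within `[0, T], continuous (X ^~ w)} /\
    {within `[0, T], continuous (B ^~ w)} /\
    forall t, t \in `[0, T] ->
      X t w = x + vint t (fun s => b s (u s)) + B t w.
  apply: probability_ae_exists; apply: filterS2 (filterI cX cB) eqX.
  by move=> w [].
have uE t : t \in `[0, T] -> u t = X t w - B t w.
  by move=> tT; rewrite eqw// addrK; exact: u_eq.
(* Used twice: for the measurability of [u] and for the majorant of the drift. *)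
have iu i : lebesgue_measure.-integrable `[0, T] (fun s => (u s 0 i)%:E).
  have iXB : lebesgue_measure.-integrable `[0, T]
      (EFin \o (fun s => X s w 0 i - B s w 0 i)).
    apply: continuous_compact_integrable; first exact: segment_compact.
    by apply: within_continuousB; exact: within_continuous_coord.
  apply: eq_integrable iXB; first exact: measurable_itv.
  by move=> s /[!inE] sT; rewrite /= uE// !mxE.
have mu : measurable_fun `[0, T] u.
  apply: measurable_fun_rV => i; apply/measurable_EFinP.
  exact: measurable_int (iu i).
have mb : measurable_fun `[0, T] (fun s => b s (u s)).
  apply: (measurable_comp (F := `[0, T] `*` [set: 'rV[R]_d])
    (f := fun p => b p.1 p.2) (g := fun s => (s, u s))) => //.
  - by apply: measurableX => //; exact: measurable_itv.
  - by move=> _ [s sT <-]; split.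
  - exact: measurable_fun_within_pair.
have [C C0 bC] := b_growth; move=> i.
have i1 : lebesgue_measure.-integrable `[0, T] (EFin \o cst (1 : R)).
  apply: continuous_compact_integrable; first exact: segment_compact.
  by move=> s; exact: cvg_cst.
(* Majorant from linear growth, with [enorm] replaced by the sum of absolute coordinates so that
   integrability follows from [iu] by linearity. *)
have iS : lebesgue_measure.-integrable `[0, T]
    (fun s => C%:E * (1 + \sum_(j < d) (`|u s 0 j|)%:E))%E.
  apply: integrableZl; first exact: measurable_itv.
  apply: integrableD i1 _; first exact: measurable_itv.
  apply: integrable_sum; first exact: measurable_itv.
  by move=> j _; exact: integrable_norm (iu j).
apply: le_integrable iS; first exact: measurable_itv.
  apply/measurable_EFinP.
  exact: measurableT_comp (measurable_coord i) mb.
move=> s sT; rewrite sumEFin -EFinD -EFinM lee_fin.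
rewrite (le_trans (le_coord_enorm _ _))// (le_trans (bC s sT (u s)))//.
rewrite (le_trans _ (ler_norm _))//.
by rewrite ler_pM2l// lerD2l enorm_le_sum.
Qed.
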